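(* The eigenvalue of the quantum Gelfand invariant $\mathrm{tr}_q\,M^m\in \mathrm{U}_q(\mathfrak{gl}_n)$ in the irreducible highest weight representation $L_q(\lambda)$ of $\mathrm{U}_q(\mathfrak{gl}_n)$, where $m\geqslant 0$ is an integer and $\lambda=(\lambda_1,\dots,\lambda_n)$ is an $n$-tuple of integers (or real numbers), is found by $$ \mathrm{tr}_q\,M^m\mapsto\sum_{k=1}^n q^{2\ell_k m}\,\frac{[\ell_1-\ell_k+1]_q\cdots[\ell_n-\ell_k+1]_q}{[\ell_1-\ell_k]_q\cdots\wedge\cdots[\ell_n-\ell_k]_q}, $$ where $\ell_i=\lambda_i+n-i$ for $i=1,\dots,n$, and the symbol $\wedge$ indicates that the zero factor $[\ell_k-\ell_k]_q$ is skipped.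
   Context: Here $q$ is a nonzero complex number which is not a root of unity. The $q$-numbers are $[k]_q=\dfrac{q^k-q^{-k}}{q-q^{-1}}$. Let $e_{ij}\in\mathrm{End}\,\mathbb{C}^n$ denote the standard matrix units and let $$R=q\sum_i e_{ii}\otimes e_{ii}+\sum_{i\neq j}e_{ii}\otimes e_{jj}+(q-q^{-1})\sum_{i<j}e_{ij}\otimes e_{ji}.$$ The quantized enveloping algebra $\mathrm{U}_q(\mathfrak{gl}_n)$ is the algebra generated by elements $l^+_{ij}$ and $l^-_{ij}$ with $1\leqslant i,j\leqslant n$ subject to the relations $$l^-_{ij}=l^+_{ji}=0\quad (1\leqslant i<j\leqslant n),\qquad l^-_{ii}\,l^+_{ii}=l^+_{ii}\,l^-_{ii}=1\quad (1\leqslant i\leqslant n),$$ $$R\,L^{\pm}_1L^{\pm}_2=L^{\pm}_2L^{\pm}_1R,\qquad R\,L^+_1L^-_2=L^-_2L^+_1R,$$ where $L^{\pm}=\sum_{i,j}e_{ij}\otimes l^{\pm}_{ij}\in \mathrm{End}\,\mathbb{C}^n\otimes \mathrm{U}_q(\mathfrak{gl}_n)$, and the subscripts $1,2$ indicate the copy of $\mathrm{End}\,\mathbb{C}^n$ in $\mathrm{End}\,\mathbb{C}^n\otimes\mathrm{End}\,\mathbb{C}^n\otimes \mathrm{U}_q(\mathfrak{gl}_n)$ in which the matrix part lies. Set $M=L^-(L^+)^{-1}$ and let $D=\mathrm{diag}[q^{n-1},q^{n-3},\dots,q^{-n+1}]$. The quantum Gelfand invariants are the quantum traces $\mathrm{tr}_q\,M^m=\mathrm{tr}\,DM^m$,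 with the trace taken over $\mathrm{End}\,\mathbb{C}^n$; they belong to the center of $\mathrm{U}_q(\mathfrak{gl}_n)$ and act by multiplication by scalars in the representations $L_q(\lambda)$. The irreducible highest weight representation $L_q(\lambda)$ of $\mathrm{U}_q(\mathfrak{gl}_n)$ is generated by a nonzero vector $\xi$ such that $l^+_{ij}\,\xi=0$ for $1\leqslant i<j\leqslant n$ and $l^-_{ii}\,\xi=q^{\lambda_i}\xi$ for $1\leqslant i\leqslant n$. *)

(* Defs.v *)
From HB Require Import structures.
From mathcomp Require Import all_boot all_order all_algebra.
From mathcomp Require Import generic_quotient ring_quotient complex mxtens.
(* the notations of monalg clash with those of mathcomp-analysis *)
From mathcomp Require Import -(notations) monalg.
From mathcomp Require Import ring.
From mathcomp Require Import boolp classical_sets reals.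
From mathcomp Require Import topology normedtype sequences exp trigo.
Set Implicit Arguments.
Unset Strict Implicit.
Unset Printing Implicit Defensive.

Import Order.TTheory GRing.Theory Num.Theory.
Import numFieldNormedType.Exports.

Local Open Scope quotient_scope.
Local Open Scope classical_set_scope.
Local Open Scope ring_scope.

(* The free algebra on [I], as the algebra of the free monoid on [I].      *)

Section FreeAlgebra.
Variables (K : fieldType) (I : choiceType).

Definition free_alg : Type := malg (fmonom I) K.

Definition free_gen (i : I) : free_alg := mkmalgU (fmu i) 1.

HB.instance Definition _ := GRing.Lalgebra.on free_alg.

Lemma malgC_comm (c : K) (x : malg (fmonom I) K) :
  mkmalgU (fmone I) c * x = x * mkmalgU (fmone I) c.
Proof.
rewrite !malgM_def fgmulUg fgmulgU; apply: eq_bigr => k _.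
by rewrite mulrC mul1m mulm1.
Qed.

Lemma free_alg_scalerAr (k : K) (x y : free_alg) : k *: (x * y) = x * (k *: y).
Proof.
have e (z : free_alg) : k *: z = (mkmalgU (fmone I) k : free_alg) * z.
  exact/esym/mul_malgC.
by rewrite !e mulrA [_ * x]malgC_comm mulrA.
Qed.

HB.instance Definition _ :=
  GRing.Lalgebra_isAlgebra.Build K free_alg free_alg_scalerAr.

End FreeAlgebra.

Section RMatrix.
Variables (K : fieldType) (q : K) (n : nat).

Definition Rmx : 'M[K]_(n * n) :=
  q *: (\sum_(i < n) delta_mx i i *t delta_mx i i)
  + \sum_(i < n) \sum_(j < n | i != j) delta_mx i i *t delta_mx j j
  + (q - q^-1) *: (\sum_(i < n) \sum_(j < n | (i < j)%N)
                     delta_mx i j *t delta_mx j i).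

(* R L_1 L'_2 - L'_2 L_1 R, where L_1 = L (x) 1 and L'_2 = 1 (x) L' *)
Definition RLL (A : algType K) (L L' : 'M[A]_n) : 'M[A]_(n * n) :=
  let R := map_mx (in_alg A) Rmx in
  let L1 := L *t 1%:M in
  let L2 := 1%:M *t L' in
  R *m L1 *m L2 - L2 *m L1 *m R.

Lemma map_RLL (A B : algType K) (f : {rmorphism A -> B}) (L L' : 'M[A]_n) :
  (forall k : K, f k%:A = k%:A) ->
  map_mx f (RLL L L') = RLL (map_mx f L) (map_mx f L').
Proof.
move=> fA; have ft (X Y : 'M[A]_n) : map_mx f (X *t Y) = map_mx f X *t map_mx f Y.
  by apply/matrixP => i j; rewrite !mxE rmorphM.
have fR : map_mx f (map_mx (in_alg A) Rmx) = map_mx (in_alg B) Rmx.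
  by apply/matrixP => i j; rewrite !mxE; apply: fA.
by rewrite /RLL map_mxB !map_mxM /= !ft fR !map_mx1.
Qed.

Lemma RLL11 (A : algType K) : RLL (1%:M : 'M[A]_n) 1%:M = 0.
Proof.
have t11 : (1%:M : 'M[A]_n) *t (1%:M : 'M[A]_n) = 1%:M.
  apply/matrixP => i j; case: (mxtens_indexP i) => i0 i1.
  case: (mxtens_indexP j) => j0 j1; rewrite tensmxE !mxE -natrM mulnb.
  by rewrite (can_eq (@mxtens_indexK _ _)).
by rewrite /RLL !t11 !mulmx1 mul1mx subrr.
Qed.

End RMatrix.

(* U_q(gl_n): the quotient of the free algebra on the l^{+-}_{ij} by the   *)
(* two-sided ideal generated by the defining relations.  The generator     *)
(* l^+_{ij} has index (true, (i, j)), and l^-_{ij} has (false, (i, j)).    *)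

Section QuantumGL.
Variables (K : fieldType) (q : K) (n : nat).

Definition Uq_free := free_alg K (bool * ('I_n * 'I_n))%type.

HB.instance Definition _ := GRing.Algebra.on Uq_free.

Definition Lfree (s : bool) : 'M[Uq_free]_n :=
  \matrix_(i, j) free_gen K (s, (i, j)).

Inductive Uq_relator : Uq_free -> Prop :=
| Uq_relator_minus (i j : 'I_n) :
    (i < j)%N -> Uq_relator (Lfree false i j)
| Uq_relator_plus (i j : 'I_n) :
    (i < j)%N -> Uq_relator (Lfree true j i)
| Uq_relator_diag_mp (i : 'I_n) :
    Uq_relator (Lfree false i i * Lfree true i i - 1)
| Uq_relator_diag_pm (i : 'I_n) :
    Uq_relator (Lfree true i i * Lfree false i i - 1)
| Uq_relator_RLL (s : bool) (a b : 'I_(n * n)) :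
    Uq_relator (RLL q (Lfree s) (Lfree s) a b)
| Uq_relator_RLL_pm (a b : 'I_(n * n)) :
    Uq_relator (RLL q (Lfree true) (Lfree false) a b).

Inductive Uq_ideal : Uq_free -> Prop :=
| Uq_ideal_rel x : Uq_relator x -> Uq_ideal x
| Uq_ideal0 : Uq_ideal 0
| Uq_idealB x y : Uq_ideal x -> Uq_ideal y -> Uq_ideal (x - y)
| Uq_idealM a x b : Uq_ideal x -> Uq_ideal (a * x * b).

Definition Uq_idealb : {pred Uq_free} := fun x => `[< Uq_ideal x >].

Lemma Uq_idealb_closed : zmod_closed Uq_idealb.
Proof.
split; first by apply/asboolP/Uq_ideal0.
by move=> x y /asboolP hx /asboolP hy; apply/asboolP/Uq_idealB.
Qed.

HB.instance Definition _ :=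
  GRing.isZmodClosed.Build Uq_free Uq_idealb Uq_idealb_closed.

Lemma Uq_idealMl (a x : Uq_free) : x \in Uq_idealb -> a * x \in Uq_idealb.
Proof. by move=> /asboolP/(Uq_idealM a 1) h; rewrite -[_ * x]mulr1; apply/asboolP. Qed.

Lemma Uq_idealMr (a x : Uq_free) : x \in Uq_idealb -> x * a \in Uq_idealb.
Proof. by move=> /asboolP/(Uq_idealM 1 a) h; rewrite -[x]mul1r; apply/asboolP. Qed.

(* The counit l^{+-}_{ij} |-> delta_{ij} shows that the ideal is proper. *)
Section Counit.

Definition counit_word (w : fmonom (bool * ('I_n * 'I_n))%type) : K :=
  \prod_(g <- (w : seq _)) (g.2.1 == g.2.2)%:R.

Lemma counit_word_mmorphism : mmorphism counit_word.
Proof.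
split; first by move=> x y; rewrite /counit_word fmM big_cat.
by rewrite /counit_word fm1 big_nil.
Qed.

HB.instance Definition _ :=
  monalg.isMultiplicative.Build _ K counit_word counit_word_mmorphism.

Definition counit_fun : Uq_free -> K^o := mmap idfun counit_word.

Lemma counit_zmod_morphism : zmod_morphism counit_fun.
Proof. exact: (raddfB (mmap idfun counit_word)). Qed.

Lemma counit_monoid_morphism : monoid_morphism counit_fun.
Proof.
by split; [exact: (rmorph1 (mmap idfun counit_word))
          |exact: (rmorphM (mmap idfun counit_word))].
Qed.

HB.instance Definition _ :=
  GRing.isZmodMorphism.Build Uq_free K^o counit_fun counit_zmod_morphism.
HB.instance Definition _ :=
  GRing.isMonoidMorphism.Build Uq_free K^o counit_fun counit_monoid_morphism.

Definition counit : {rmorphism Uq_free -> K^o} := counit_fun.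

Lemma counit_Lfree s : map_mx counit (Lfree s) = 1%:M.
Proof.
apply/matrixP => i j; rewrite !mxE /counit /= /counit_fun mmapU mul1r /counit_word fmU.
by rewrite big_seq1.
Qed.

Lemma counit_ideal x : Uq_ideal x -> counit x = 0.
Proof.
have cA (k : K) : counit (k%:A : Uq_free) = k.
  by rewrite /counit /= /counit_fun mmapZ /= rmorph1 mulr1.
have cL s i j : counit (Lfree s i j) = (i == j)%:R.
  by have /matrixP/(_ i j) := counit_Lfree s; rewrite !mxE.
have cRLL s t : map_mx counit (RLL q (Lfree s) (Lfree t)) = 0.
  rewrite (map_RLL q (f := counit)) ?counit_Lfree ?RLL11// => k.
    by rewrite cA -[LHS]mulr1.
elim=> {x} [x|||].
- case=> [i j ij|i j ij|i|i|s a b|a b].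
  + by rewrite cL -val_eqE (ltn_eqF ij).
  + by rewrite cL -val_eqE (gtn_eqF ij).
  + by rewrite rmorphB rmorphM rmorph1 !cL eqxx mulr1 subrr.
  + by rewrite rmorphB rmorphM rmorph1 !cL eqxx mulr1 subrr.
  + by have /matrixP/(_ a b) := cRLL s s; rewrite mxE => ->; rewrite mxE.
  + by have /matrixP/(_ a b) := cRLL true false; rewrite mxE => ->; rewrite mxE.
- exact: rmorph0.
- by move=> x y _ x0 _ y0; rewrite rmorphB x0 y0 subrr.
- by move=> a x b _ x0; rewrite !rmorphM x0 mulr0 mul0r.
Qed.

End Counit.

Definition Uq : Type := Quotient.quot Uq_idealb.

HB.instance Definition _ := GRing.Zmodule.on Uq.
HB.instance Definition _ := EqQuotient.on Uq.

Lemma Uq_eqP (x y : Uq_free) : \pi_Uq x = \pi_Uq y <-> x - y \in Uq_idealb.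
Proof. by rewrite (Quotient.idealrBE Uq_idealb); split=> /eqP. Qed.

Definition Uq_pi (x : Uq_free) : Uq := \pi_Uq x.

Definition Uq_one : Uq := lift_cst Uq 1.
Definition Uq_mul : Uq -> Uq -> Uq := lift_op2 Uq *%R.
Definition Uq_scale (k : K) : Uq -> Uq := lift_op1 Uq ( *:%R k).

Lemma Uq_piP (x : Uq) : exists y, x = Uq_pi y.
Proof. by exists (repr x); rewrite /Uq_pi reprK. Qed.

Lemma repr_Uq_pi x : repr (Uq_pi x) - x \in Uq_idealb.
Proof. by apply/Uq_eqP; rewrite reprK. Qed.

Lemma Uq_piB x y : Uq_pi (x - y) = Uq_pi x - Uq_pi y.
Proof. exact: (pi_is_zmod_morphism (Quotient.quot Uq_idealb)). Qed.

Lemma Uq_piM x y : Uq_pi (x * y) = Uq_mul (Uq_pi x) (Uq_pi y).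
Proof.
rewrite /Uq_mul; unlock; apply/esym/Uq_eqP; set u := repr _; set v := repr _.
have -> : u * v - x * y = (u - x) * v + x * (v - y).
  by rewrite mulrBl mulrBr addrA subrK.
apply: rpredD; first by apply: Uq_idealMr; apply: repr_Uq_pi.
by apply: Uq_idealMl; apply: repr_Uq_pi.
Qed.

Lemma Uq_piZ k x : Uq_pi (k *: x) = Uq_scale k (Uq_pi x).
Proof.
rewrite /Uq_scale; unlock; apply/esym/Uq_eqP; rewrite -scalerBr -mulr_algl.
by apply: Uq_idealMl; apply: repr_Uq_pi.
Qed.

Lemma Uq_pi1 : Uq_pi 1 = Uq_one.
Proof. by rewrite /Uq_one; unlock. Qed.

Lemma Uq_mulA : associative Uq_mul.
Proof.
move=> x y z; case: (Uq_piP x) (Uq_piP y) (Uq_piP z) => x0 -> [y0 ->] [z0 ->].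
by rewrite -!Uq_piM mulrA.
Qed.

Lemma Uq_mul1 : left_id Uq_one Uq_mul.
Proof. by move=> x; have [x0 ->] := Uq_piP x; rewrite -Uq_pi1 -Uq_piM mul1r. Qed.

Lemma Uq_mulr1 : right_id Uq_one Uq_mul.
Proof. by move=> x; have [x0 ->] := Uq_piP x; rewrite -Uq_pi1 -Uq_piM mulr1. Qed.

Lemma Uq_piD x y : Uq_pi (x + y) = Uq_pi x + Uq_pi y.
Proof. by rewrite -[in RHS](addrK y x) Uq_piB subrK. Qed.

Lemma Uq_mulDl : left_distributive Uq_mul +%R.
Proof.
move=> x y z; case: (Uq_piP x) (Uq_piP y) (Uq_piP z) => x0 -> [y0 ->] [z0 ->].
by rewrite -Uq_piD -!Uq_piM mulrDl Uq_piD.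
Qed.

Lemma Uq_mulDr : right_distributive Uq_mul +%R.
Proof.
move=> x y z; case: (Uq_piP x) (Uq_piP y) (Uq_piP z) => x0 -> [y0 ->] [z0 ->].
by rewrite -Uq_piD -!Uq_piM mulrDr Uq_piD.
Qed.

Lemma Uq_one_neq0 : Uq_one != 0.
Proof.
apply/eqP; rewrite -[0](subrr Uq_one) -Uq_pi1 -Uq_piB subrr => /Uq_eqP.
rewrite subr0 => /asboolP/counit_ideal; rewrite rmorph1 => /eqP.
by rewrite oner_eq0.
Qed.

HB.instance Definition _ := GRing.Zmodule_isNzRing.Build Uq
  Uq_mulA Uq_mul1 Uq_mulr1 Uq_mulDl Uq_mulDr Uq_one_neq0.

Lemma Uq_scaleA a b (x : Uq) : Uq_scale a (Uq_scale b x) = Uq_scale (a * b) x.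
Proof. by have [x0 ->] := Uq_piP x; rewrite -!Uq_piZ scalerA. Qed.

Lemma Uq_scale1 : left_id 1 Uq_scale.
Proof. by move=> x; have [x0 ->] := Uq_piP x; rewrite -Uq_piZ scale1r. Qed.

Lemma Uq_scaleDr : right_distributive Uq_scale +%R.
Proof.
move=> a x y; case: (Uq_piP x) (Uq_piP y) => x0 -> [y0 ->].
by rewrite -Uq_piD -!Uq_piZ scalerDr Uq_piD.
Qed.

Lemma Uq_scaleDl (x : Uq) : {morph Uq_scale^~ x : a b / a + b}.
Proof.
by move=> a b; have [x0 ->] := Uq_piP x; rewrite -!Uq_piZ scalerDl Uq_piD.
Qed.

HB.instance Definition _ := GRing.Zmodule_isLmodule.Build K Uq
  Uq_scaleA Uq_scale1 Uq_scaleDr Uq_scaleDl.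

Lemma Uq_scaleAl a (x y : Uq) : a *: (x * y) = (a *: x) * y.
Proof.
case: (Uq_piP x) (Uq_piP y) => x0 -> [y0 ->].
rewrite -[_ * _]/(Uq_mul _ _) -[_ *: Uq_mul _ _]/(Uq_scale _ _).
rewrite -[_ *: _]/(Uq_scale _ _) -[RHS]/(Uq_mul _ _).
by rewrite -Uq_piZ -!Uq_piM -Uq_piZ scalerAl.
Qed.

HB.instance Definition _ := GRing.Lmodule_isLalgebra.Build K Uq Uq_scaleAl.

Lemma Uq_scaleAr a (x y : Uq) : a *: (x * y) = x * (a *: y).
Proof.
case: (Uq_piP x) (Uq_piP y) => x0 -> [y0 ->].
rewrite -[_ * _]/(Uq_mul _ _) -[_ *: Uq_mul _ _]/(Uq_scale _ _).
rewrite -[_ *: _]/(Uq_scale _ _) -[RHS]/(Uq_mul _ _).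
by rewrite -Uq_piZ -!Uq_piM -Uq_piZ scalerAr.
Qed.

HB.instance Definition _ := GRing.Lalgebra_isAlgebra.Build K Uq Uq_scaleAr.

Lemma Uq_pi_monoid_morphism : monoid_morphism Uq_pi.
Proof. by split; [exact: Uq_pi1 | exact: Uq_piM]. Qed.

HB.instance Definition _ :=
  GRing.isZmodMorphism.Build Uq_free Uq Uq_pi Uq_piB.
HB.instance Definition _ :=
  GRing.isMonoidMorphism.Build Uq_free Uq Uq_pi Uq_pi_monoid_morphism.
HB.instance Definition _ :=
  GRing.isScalable.Build K Uq_free Uq *:%R Uq_pi Uq_piZ.

(* [Lmx true] is L^+ and [Lmx false] is L^- *)
Definition Lmx (s : bool) : 'M[Uq]_n := map_mx Uq_pi (Lfree s).

Lemma Uq_pi_rel x : Uq_relator x -> Uq_pi x = 0.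
Proof.
move=> hx; rewrite -(subrr (Uq_pi 0)) -Uq_piB subrr; apply/Uq_eqP.
by rewrite subr0; apply/asboolP/Uq_ideal_rel.
Qed.

Lemma Lmx_minus0 (i j : 'I_n) : (i < j)%N -> Lmx false i j = 0.
Proof. by move=> ij; rewrite mxE; apply/Uq_pi_rel/Uq_relator_minus. Qed.

Lemma Lmx_plus0 (i j : 'I_n) : (i < j)%N -> Lmx true j i = 0.
Proof. by move=> ij; rewrite mxE; apply/Uq_pi_rel/Uq_relator_plus. Qed.

Lemma Lmx_diag_mp (i : 'I_n) : Lmx false i i * Lmx true i i = 1.
Proof.
apply/eqP; rewrite -subr_eq0 [Lmx false i i]mxE [Lmx true i i]mxE -rmorphM -(rmorph1 Uq_pi) -rmorphB.
exact/eqP/Uq_pi_rel/Uq_relator_diag_mp.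
Qed.

Lemma Lmx_diag_pm (i : 'I_n) : Lmx true i i * Lmx false i i = 1.
Proof.
apply/eqP; rewrite -subr_eq0 [Lmx false i i]mxE [Lmx true i i]mxE -rmorphM -(rmorph1 Uq_pi) -rmorphB.
exact/eqP/Uq_pi_rel/Uq_relator_diag_pm.
Qed.

Lemma Uq_pi_RLL s t : (forall a b, Uq_relator (RLL q (Lfree s) (Lfree t) a b)) ->
  RLL q (Lmx s) (Lmx t) = 0.
Proof.
move=> h; have pA (k : K) : Uq_pi k%:A = k%:A by rewrite Uq_piZ Uq_pi1.
rewrite /Lmx -(map_RLL q _ _ pA); apply/matrixP => a b.
by rewrite [LHS]mxE [in RHS]mxE; apply: Uq_pi_rel.
Qed.

Lemma Lmx_RLL s : RLL q (Lmx s) (Lmx s) = 0.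
Proof. by apply: Uq_pi_RLL => a b; apply: Uq_relator_RLL. Qed.

Lemma Lmx_RLL_pm : RLL q (Lmx true) (Lmx false) = 0.
Proof. by apply: Uq_pi_RLL => a b; apply: Uq_relator_RLL_pm. Qed.

(* L^+ = T^-1 (1 - N) with T the diagonal part of L^- and N strictly upper  *)
(* triangular; hence (L^+)^-1 = (1 + N + ... + N^(n-1)) T.                  *)
Definition Lplus_inv : 'M[Uq]_n :=
  let T := diag_mx (\row_i Lmx false i i) in
  let N := 1%:M - T *m Lmx true in
  (\sum_(k < n) N ^+ k) *m T.

Lemma strict_upper_nilpotent (N : 'M[Uq]_n) :
  (forall i j : 'I_n, (j <= i)%N -> N i j = 0) -> N ^+ n = 0.
Proof.
move=> N0; have H k (i j : 'I_n) : (j < i + k)%N -> (N ^+ k) i j = 0.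
  elim: k i j => [|k IH] i j ij.
    by rewrite expr0 mxE -val_eqE gtn_eqF // -[X in (_ < X)%N]addn0.
  rewrite exprS mxE big1 // => l _.
  have [li|il] := leqP l i; first by rewrite N0 // mul0r.
  by rewrite IH ?mulr0 //; apply: leq_trans ij _; rewrite addnS -addSn leq_add2r.
apply/matrixP => i j; rewrite mxE; apply: H.
by apply: leq_trans (ltn_ord j) _; rewrite leq_addl.
Qed.

Section LplusInv.
Let T : 'M[Uq]_n := diag_mx (\row_i Lmx false i i).
Let T' : 'M[Uq]_n := diag_mx (\row_i Lmx true i i).
Let N := 1%:M - T *m Lmx true.

Let N0 : N ^+ n = 0.
Proof.
apply: strict_upper_nilpotent => i j; rewrite leq_eqVlt => /orP[/eqP/val_inj ->|ji].
  by rewrite mxE [(- _ : 'M__) i i]mxE mul_diag_mx [(\matrix_(_, _) _) i i]mxE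
    [(\row__ _) 0 i]mxE Lmx_diag_mp mxE eqxx subrr.
rewrite mxE [(- _ : 'M__) i j]mxE mul_diag_mx [(\matrix_(_, _) _) i j]mxE.
by rewrite (Lmx_plus0 ji) mulr0 oppr0 mxE -val_eqE gtn_eqF // addr0.
Qed.
Let TL : T *m Lmx true = 1%:M - N.
Proof. by rewrite /N opprB addrC subrK. Qed.

Let geomr : (1%:M - N) *m (\sum_(k < n) N ^+ k) = 1%:M.
Proof.
have := subrX1 N n; rewrite N0 sub0r => /(congr1 -%R); rewrite opprK => e.
by rewrite [RHS]e -mulNr [in RHS]opprB.
Qed.

Let geoml : (\sum_(k < n) N ^+ k) *m (1%:M - N) = 1%:M.
Proof.
have c : GRing.comm (1 - N) (\sum_(k < n) N ^+ k).
  apply: commr_sum => k _; apply/commr_sym/commrB; first exact: commr1.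
  exact/commr_sym/commrX.
by rewrite -[RHS]geomr; apply: esym c.
Qed.

Let T'T : T' *m T = 1%:M.
Proof.
rewrite mulmx_diag -diag_const_mx; congr diag_mx; apply/rowP => i.
by rewrite [LHS]mxE [X in X * _]mxE [X in _ * X]mxE Lmx_diag_pm mxE.
Qed.

Lemma mulVLplus : Lplus_inv *m Lmx true = 1%:M.
Proof. by rewrite /Lplus_inv -/T -/N -mulmxA TL geoml. Qed.

Lemma mulLplusV : Lmx true *m Lplus_inv = 1%:M.
Proof.
have -> : Lmx true = T' *m (1%:M - N) by rewrite -TL mulmxA T'T mul1mx.
by rewrite /Lplus_inv -/T -/N mulmxA -(mulmxA T') geomr mulmx1 T'T.
Qed.

End LplusInv.

Definition Mmx : 'M[Uq]_n := Lmx false *m Lplus_inv.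

(* 0-based indices: the exponent n - 1 - 2 i runs from n - 1 to - n + 1 *)
Definition Dmx : 'M[Uq]_n :=
  diag_mx (\row_(i < n) (q ^ (n%:Z - 1 - (2 * i)%:Z))%:A).

Definition trq (X : 'M[Uq]_n) : Uq := \tr (Dmx *m X).

Definition irreducible_module (V : lmodType Uq) :=
  (exists v : V, v != 0) /\
  forall S : {pred V}, submod_closed S -> S =i pred1 0 \/ S =i predT.

Definition highest_weight_vector (V : lmodType Uq) (w : 'I_n -> K) (xi : V) :=
  [/\ xi != 0,
      forall i j : 'I_n, (i < j)%N -> Lmx true i j *: xi = 0,
      forall i : 'I_n, Lmx false i i *: xi = (w i)%:A *: xi
    & forall v : V, exists u : Uq, v = u *: xi].

End QuantumGL.

(* Real powers of a complex number q depend on the choice of a logarithm h *)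
(* of q: q^a = exp (h a).  By [cexp_surj] every q != 0 has a logarithm, and *)
(* by [qpow_int] integer powers do not depend on the choice.               *)

Section QNumbers.
Variable R : realType.
Local Open Scope complex_scope.
Implicit Types (z h : R[i]) (a b : R).

Definition cexp z : R[i] :=
  (expR (complex.Re z))%:C * (cos (complex.Im z) +i* sin (complex.Im z)).

Definition qpow h a : R[i] := cexp (h * a%:C).

Definition qnum h a : R[i] :=
  (qpow h a - qpow h (- a)) / (cexp h - (cexp h)^-1).

Lemma cexpD z z' : cexp (z + z') = cexp z * cexp z'.
Proof.
case: z z' => [a b] [c d]; rewrite /cexp /= expRD cosD sinD rmorphM /=.
rewrite mulrACA; congr (_ * _); apply/eqP; rewrite eq_complex /= eqxx /=.
by rewrite addrC eqxx.
Qed.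

Lemma cexp0 : cexp 0 = 1.
Proof. by rewrite /cexp /= expR0 cos0 sin0 mul1r. Qed.

Lemma cexp_neq0 z : cexp z != 0.
Proof.
apply/eqP => z0; have := cexp0; rewrite -(subrr z) cexpD z0 mul0r => /eqP.
by rewrite eq_sym oner_eq0.
Qed.

Lemma qpow_int h (k : int) : qpow h k%:~R = cexp h ^ k.
Proof.
have P (n : nat) : qpow h n%:R = cexp h ^+ n.
  elim: n => [|n IH]; first by rewrite /qpow rmorph0 mulr0 cexp0 expr0.
  by rewrite exprS -IH /qpow -cexpD -natr1 rmorphD mulrDr rmorph1 mulr1 addrC.
case: k => n; first exact: P.
rewrite NegzE -exprnN -P; apply: (mulIf (cexp_neq0 (h * n.+1%:R%:C))).
rewrite mulVf ?cexp_neq0 // -cexpD -mulrDr -rmorphD /= mulrNz addNr.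
by rewrite rmorph0 mulr0 cexp0.
Qed.

Lemma cexp_surj z : z != 0 -> exists h, cexp h = z.
Proof.
case: z => a b z0; set r := Num.sqrt (a ^+ 2 + b ^+ 2).
have r2 : r ^+ 2 = a ^+ 2 + b ^+ 2 by rewrite sqr_sqrtr // addr_ge0 ?sqr_ge0.
have rgt0 : 0 < r.
  rewrite sqrtr_gt0 lt0r addr_ge0 ?sqr_ge0 // andbT paddr_eq0 ?sqr_ge0 //.
  by rewrite !sqrf_eq0; move: z0; rewrite eq_complex.
have r0 : r != 0 by rewrite gt_eqF.
pose x := a / r; pose t := acos x.
have x2 : 1 - x ^+ 2 = (b / r) ^+ 2.
  by rewrite !exprMn exprVn r2; field; rewrite -r2 expf_neq0.
have x1 : -1 <= x <= 1.
  by rewrite -ler_norml -(@expr_le1 _ 2) ?normr_ge0 // real_normK ?num_real // -subr_ge0 x2 sqr_ge0.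
have cost : cos t = x by rewrite acosK.
have sint : sin t = `|b| / r.
  by rewrite sin_acos // x2 sqrtr_sqr normrM normfV (gtr0_norm rgt0).
exists (ln r +i* (if 0 <= b then t else - t)).
rewrite /cexp /= lnK ?posrE //; apply/eqP.
case: ifPn => [b0|]; rewrite ?cosN ?sinN cost sint.
  by rewrite ger0_norm // eq_complex /= !mul0r subr0 addr0 !mulrA ![r * _]mulrC !mulfK // !eqxx.
rewrite -ltNge => b0; rewrite ltr0_norm // mulNr opprK.
by rewrite eq_complex /= !mul0r subr0 addr0 !mulrA ![r * _]mulrC !mulfK // !eqxx.
Qed.

Section Weights.
Variables (n : nat) (h : R[i]).

(* 0-based indices: l_i = lambda_i + n - (i + 1) *)
Definition ell (lambda : 'rV[R]_n) (i : 'I_n) : R :=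
  lambda 0 i + (n - i.+1)%:R.

Definition gelfand_eigenvalue (m : nat) (lambda : 'rV[R]_n) : R[i] :=
  \sum_(k < n)
    qpow h (2 * ell lambda k * m%:R) *
    (\prod_(i < n) qnum h (ell lambda i - ell lambda k + 1)) /
    (\prod_(i < n | i != k) qnum h (ell lambda i - ell lambda k)).

(* The weights at which the denominators do not vanish.  Elsewhere          *)
(* [gelfand_eigenvalue] has a junk value (x / 0 = 0); there the formula is  *)
(* to be read as its limit along regular weights, which form a dense set    *)
(* unless q is a root of unity.                                             *)
Definition regular_weight (lambda : 'rV[R]_n) : Prop :=
  forall i k : 'I_n, i != k -> qnum h (ell lambda i - ell lambda k) != 0.

End Weights.
End QNumbers.

(* Main.v *)
Require Import Defs.
From mathcomp Require Import all_boot all_order all_algebra complex mxtens.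
From mathcomp Require Import -(notations) monalg.
From mathcomp Require Import ring.
From mathcomp Require Import boolp classical_sets reals.
From mathcomp Require Import topology normedtype sequences exp trigo.
Set Implicit Arguments.
Unset Strict Implicit.
Unset Printing Implicit Defensive.
Import Order.TTheory GRing.Theory Num.Theory.
Import numFieldNormedType.Exports.
Local Open Scope ring_scope.

(** Indices run from 0, and xi denotes the highest weight vector.

    Centrality.  Write L_1 and L_2 for the two embeddings of a matrix L in the
    tensor square.  The defining relations give
      R L^+_1 M_2 = M_2 R L^+_1  and  R^-1 L^-_2 M_1 = M_1 R^-1 L^-_2,
    and both pass to the powers N = M^m ([exchange_plus], [exchange_minus]).
    So conjugating N_2 by L^+_1 is conjugating it by R^-1, and the partial
    quantum trace of R^-1 N_2 R is tr_q N times the identity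
    ([qtrace_leg2]); hence tr_q N commutes with all l^+_ij, and in the same
    way with all l^-_ij.  It is therefore enough to compute tr_q M^m on the
    highest weight vector, which generates the module.

    The recursion.  By induction on m, (M^m)_ij xi = 0 for i < j and
    (M^m)_ii xi = nu_i xi for a scalar nu_i = nu_i(m).  Indeed (M^(m+1))_ii xi
    is, up to a scalar, the sum over k of N_ik l^-_ki xi, and an entry of
    the second exchange relation expresses each summand by the previous ones
    and nu_k, so the partial sums solve a first order linear recursion.  With
    x_i = q^(2 l_i), p = q^-2 and sigma_i = sum_(j >= i) p^(j - i) nu_j, this gives
      nu_i(m + 1) = x_i (sigma_i(m) - sigma_(i+1)(m))
    ([Mpow_highest_weight]), while tr_q M^m acts on xi by q^(n-1) sigma_0(m).

    The closed form.  The sums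
      W_i(m) = sum_(k >= i) x_k^m prod_(j >= i, j <> k) (x_j - p x_k) / (x_j - x_k)
    satisfy the recursion of sigma_i(m); the initial values at m = 0 agree by
    the partial fraction expansion of prod_j (x_j - p z) / (x_j - z)
    ([partial_fractions]).  Rewritten in q-numbers, q^(n-1) W_0(m) is the
    stated formula ([gelfand_poly_regular]).

    The recursion involves no division, so it defines a polynomial in the x_i:
    a continuous function of the weight.  This yields the eigenvalue at
    the weights where the closed form has vanishing denominators, as the limit
    of its values at regular weights. *)

Local Notation "⟦ a , b ⟧" := (mxtens_index (a, b)) (format "⟦ a ,  b ⟧").

(** * Two-leg matrices with entries in a non-commutative ring *)

Section TensorEntries.
Variables (A : nzRingType) (n : nat).
Implicit Types X Y : 'M[A]_n.

Definition leg1 X : 'M[A]_(n * n) := X *t 1%:M.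
Definition leg2 X : 'M[A]_(n * n) := 1%:M *t X.

Lemma leg1E X a b c d : leg1 X ⟦a, b⟧ ⟦c, d⟧ = X a c *+ (b == d).
Proof. by rewrite tensmxE mxE mulr_natr. Qed.

Lemma leg2E X a b c d : leg2 X ⟦a, b⟧ ⟦c, d⟧ = X b d *+ (a == c).
Proof. by rewrite tensmxE mxE mulr_natl. Qed.

Lemma sum_mxtens (F : 'I_(n * n) -> A) :
  \sum_k F k = \sum_a \sum_b F ⟦a, b⟧.
Proof.
rewrite pair_big (reindex (@mxtens_index n n)) /=.
  by apply: eq_bigr => -[a b] _.
by exists (@mxtens_unindex n n) => k _; rewrite ?mxtens_indexK ?mxtens_unindexK.
Qed.

Lemma mxtensP (X Y : 'M[A]_(n * n)) :
  (forall a b c d, X ⟦a, b⟧ ⟦c, d⟧ = Y ⟦a, b⟧ ⟦c, d⟧) -> X = Y.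
Proof.
move=> XY; apply/matrixP => i j.
by case: (mxtens_indexP i) => a b; case: (mxtens_indexP j) => c d.
Qed.

Lemma mul_leg1E X (Z : 'M[A]_(n * n)) a b z :
  (leg1 X *m Z) ⟦a, b⟧ z = \sum_x X a x * Z ⟦x, b⟧ z.
Proof.
rewrite mxE sum_mxtens; apply: eq_bigr => x _.
rewrite (bigD1 b) //= leg1E eqxx mulr1n big1 ?addr0 // => y /negPf yb.
by rewrite leg1E eq_sym yb mul0r.
Qed.

Lemma mul_leg2E X (Z : 'M[A]_(n * n)) a b z :
  (leg2 X *m Z) ⟦a, b⟧ z = \sum_y X b y * Z ⟦a, y⟧ z.
Proof.
rewrite mxE sum_mxtens (bigD1 a) //= [X in _ + X]big1 ?addr0.
  by apply: eq_bigr => y _; rewrite leg2E eqxx.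
by move=> x /negPf xa; rewrite big1 // => y _; rewrite leg2E eq_sym xa mul0r.
Qed.

Lemma mulmx_leg1E X (Z : 'M[A]_(n * n)) z c d :
  (Z *m leg1 X) z ⟦c, d⟧ = \sum_x Z z ⟦x, d⟧ * X x c.
Proof.
rewrite mxE sum_mxtens; apply: eq_bigr => x _.
rewrite (bigD1 d) //= leg1E eqxx mulr1n big1 ?addr0 // => y /negPf yd.
by rewrite leg1E yd mulr0.
Qed.

Lemma mulmx_leg2E X (Z : 'M[A]_(n * n)) z c d :
  (Z *m leg2 X) z ⟦c, d⟧ = \sum_y Z z ⟦c, y⟧ * X y d.
Proof.
rewrite mxE sum_mxtens (bigD1 c) //= [X in _ + X]big1 ?addr0.
  by apply: eq_bigr => y _; rewrite leg2E eqxx.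
by move=> x /negPf xc; rewrite big1 // => y _; rewrite leg2E xc mulr0.
Qed.

Lemma leg1M X Y : leg1 (X *m Y) = leg1 X *m leg1 Y.
Proof.
apply: mxtensP => a b c d; rewrite mul_leg1E leg1E mxE -sumrMnl.
by apply: eq_bigr => x _; rewrite leg1E mulrnAr.
Qed.

Lemma leg2M X Y : leg2 (X *m Y) = leg2 X *m leg2 Y.
Proof.
apply: mxtensP => a b c d; rewrite mul_leg2E leg2E mxE -sumrMnl.
by apply: eq_bigr => x _; rewrite leg2E mulrnAr.
Qed.

Lemma leg1_1 : leg1 1%:M = 1%:M.
Proof.
apply: mxtensP => a b c d; rewrite leg1E !mxE -mulrnA mulnb.
by rewrite (can_eq (@mxtens_indexK _ _)).
Qed.

Lemma leg2_1 : leg2 1%:M = 1%:M. Proof. exact: leg1_1. Qed.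

Lemma leg12E X Y a b c d : (leg1 X *m leg2 Y) ⟦a, b⟧ ⟦c, d⟧ = X a c * Y b d.
Proof.
rewrite mul_leg1E (bigD1 c) //= leg2E eqxx big1 ?addr0 // => x /negPf xc.
by rewrite leg2E xc mulr0.
Qed.

Lemma leg21E X Y a b c d : (leg2 Y *m leg1 X) ⟦a, b⟧ ⟦c, d⟧ = Y b d * X a c.
Proof.
rewrite mul_leg2E (bigD1 d) //= leg1E eqxx big1 ?addr0 // => x /negPf xd.
by rewrite leg1E xd mulr0.
Qed.

End TensorEntries.

(** * The R-matrix on two-leg matrices *)

Section RAction.
Variables (K : fieldType) (n : nat).
Implicit Types q : K.

Lemma RmxE q a b c d :
  Rmx q n ⟦a, b⟧ ⟦c, d⟧ =
    (if a == b then q else 1) *+ ((a == c) && (b == d))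
    + (q - q^-1) *+ [&& (a < b)%N, a == d & b == c].
Proof.
have tE (i j k l : 'I_n) :
    (delta_mx i j *t delta_mx k l : 'M[K]_(n * n)) ⟦a, b⟧ ⟦c, d⟧
    = [&& a == i, c == j, b == k & d == l]%:R.
  by rewrite tensmxE !mxE -natrM mulnb -!andbA.
rewrite /Rmx !mxE !summxE; congr (_ + _).
  rewrite (bigD1 a) //= tE eqxx /= big1 ?addr0; last first.
    by move=> i /negPf ia; rewrite tE eq_sym ia.
  rewrite (bigD1 a) //= summxE [X in _ + (_ + X)]big1 ?addr0; last first.
    move=> i /negPf ia; rewrite summxE big1 // => j _.
    by rewrite tE eq_sym ia.
  have [ab|ab] := eqVneq a b.
    rewrite -ab in tE *.
    rewrite big1 ?addr0; last by move=> j aj; rewrite tE eqxx /= (negPf aj) andbF.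
    by rewrite /= mulr_natr (eq_sym a) (eq_sym a).
  rewrite /= !andbF mulr0 add0r (bigD1 b) //= big1 ?addr0; last first.
    by move=> j /andP[_ jb]; rewrite tE (eq_sym b) (negPf jb) /= !andbF.
  by rewrite tE !eqxx /= (eq_sym a) (eq_sym b).
rewrite (bigD1 a) //= summxE [X in _ * (_ + X)]big1 ?addr0; last first.
  by move=> i /negPf ia; rewrite summxE big1 // => j _; rewrite tE eq_sym ia.
have [ab|ba] := ltnP a b; last first.
  rewrite big1 /= ?mulr0 // => j aj; rewrite tE eqxx /=.
  have /negPf -> : b != j by apply/eqP => bj; rewrite leqNgt bj aj in ba.
  by rewrite andbF.
rewrite (bigD1 b) //= big1 ?addr0; last first.
  by move=> j /andP[_ jb]; rewrite tE (eq_sym b) (negPf jb) /= !andbF.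
by rewrite tE !eqxx /= mulr_natr (eq_sym a) (eq_sym b) andbC.
Qed.

Variables (A : algType K).

Definition RmxA q : 'M[A]_(n * n) := map_mx (in_alg A) (Rmx q n).

(** Each row of R has at most two non-zero entries, so multiplying by R only
    mixes the rows (a, b) and (b, a). *)
Lemma mul_RmxE q (Z : 'M[A]_(n * n)) a b z :
  (RmxA q *m Z) ⟦a, b⟧ z =
    (if a == b then q else 1) *: Z ⟦a, b⟧ z
    + (if (a < b)%N then q - q^-1 else 0) *: Z ⟦b, a⟧ z.
Proof.
rewrite mxE sum_mxtens.
under eq_bigr => x _ do under eq_bigr => y _ do
  rewrite mxE RmxE in_algE mulr_algl scalerDl.
under eq_bigr do rewrite big_split.
rewrite big_split /=; congr (_ + _).
  rewrite (bigD1 a) //= (bigD1 b) //= !eqxx big1 ?addr0; last first.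
    by move=> y /negPf yb; rewrite (eq_sym b y) yb andbF scale0r.
  rewrite big1 ?addr0 // => x /negPf xa; rewrite big1 // => y _.
  by rewrite (eq_sym a x) xa scale0r.
rewrite (bigD1 b) //= (bigD1 a) //= !eqxx !andbT big1 ?addr0; last first.
  by move=> y /negPf yb; rewrite (eq_sym a y) yb andbF scale0r.
rewrite big1 ?addr0; first by case: ifP.
move=> x /negPf xb; rewrite big1 // => y _.
by rewrite (eq_sym b x) xb !andbF scale0r.
Qed.

Lemma mulmx_RmxE q (Z : 'M[A]_(n * n)) z c d :
  (Z *m RmxA q) z ⟦c, d⟧ =
    (if c == d then q else 1) *: Z z ⟦c, d⟧
    + (if (d < c)%N then q - q^-1 else 0) *: Z z ⟦d, c⟧.
Proof.
rewrite mxE sum_mxtens.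
under eq_bigr => x _ do under eq_bigr => y _ do
  rewrite mxE RmxE in_algE mulr_algr scalerDl.
under eq_bigr do rewrite big_split.
rewrite big_split /=; congr (_ + _).
  rewrite (bigD1 c) //= (bigD1 d) //= !eqxx big1 ?addr0; last first.
    by move=> y /negPf yb; rewrite yb andbF scale0r.
  rewrite big1 ?addr0 // => x /negPf xa; rewrite big1 // => y _.
  by rewrite xa scale0r.
rewrite (bigD1 d) //= (bigD1 c) //= !eqxx !andbT big1 ?addr0; last first.
  by move=> y /negPf yb; rewrite yb !andbF scale0r.
rewrite big1 ?addr0; first by case: ifP.
move=> x /negPf xb; rewrite big1 // => y _.
by rewrite xb !andbF scale0r.
Qed.

(** On the indices (a, b) and (b, a) with a < b, R is the unipotent block with
    off-diagonal entry q - q^-1, which changes sign when q is replaced by q^-1. *)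
Lemma RmxAV q : q != 0 -> RmxA q^-1 *m RmxA q = 1%:M.
Proof.
move=> q0; rewrite -[RmxA q]mulmx1 mulmxA; apply/matrixP => i j.
case: (mxtens_indexP i) => a b; rewrite -mulmxA 2!mul_RmxE invrK.
have [<-|ab] := eqVneq a b.
  by rewrite ltnn !scale0r !addr0 scalerA mulVf // scale1r.
rewrite !scale1r [X in _ + _ *: X]mul_RmxE [b == a]eq_sym (negPf ab) scale1r.
case: (ltngtP a b) => [||/val_inj /eqP]; last by rewrite (negPf ab).
  by rewrite scale0r addr0 -addrA -scalerDl addrA subrK subrr scale0r addr0.
by rewrite !scale0r !addr0.
Qed.

End RAction.

(** * Partial quantum traces *)

Section QuantumTrace.
Variables (K : fieldType) (q : K) (n : nat).
Hypothesis q0 : q != 0.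
Local Notation eps := (q - q^-1).

Definition qdim_weight (b : nat) : K := q ^ (n%:Z - 1 - (2 * b)%:Z).
Local Notation D := qdim_weight.

Lemma qdim_weightS b : q * D b.+1 = q^-1 * D b.
Proof.
rewrite /D -[X in X * _](expr1z q) -exprN1 -!expfzDr //; congr (_ ^ _).
by rewrite mulnS PoszD; ring.
Qed.

(** The summand is a difference because
    (q - q^-1) q^(n-1-2b) = q q^(n-1-2b) - q q^(n-1-2(b+1)). *)
Lemma qdim_weight_telescope (a x : nat) : (a < x)%N ->
  eps * (\sum_(a.+1 <= b < x) D b) = q^-1 * D a - q * D x.
Proof.
move=> ax; rewrite -qdim_weightS big_distrr /= -[RHS]opprB.
rewrite -(telescope_sumr (fun b => q * D b)) // -sumrN.
by apply: eq_bigr => b _; rewrite qdim_weightS; ring.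
Qed.

(** The coefficient of the entry N_ax, a < x, in the partial quantum trace of
    R^-1 N_2 R at position (a, x): its vanishing is what singles out the weights
    q^(n-1-2b). *)
Lemma qtrace_offdiag (a x : 'I_n) : (a < x)%N ->
  \sum_(b < n) D b * (- (eps * q) *+ (b == x) + eps * q^-1 *+ (b == a)
     - eps ^+ 2 *+ ((a < b)%N && (b < x)%N)) = 0.
Proof.
move=> ax; under eq_bigr do rewrite mulrDr mulrDr.
rewrite !big_split /= (bigD1 x) //= eqxx big1 ?addr0; last first.
  by move=> b /negPf bx; rewrite bx mulr0.
rewrite (bigD1 a) //= eqxx big1 ?addr0; last first.
  by move=> b /negPf ba; rewrite ba mulr0.
have -> : \sum_(b < n) D b * - (eps ^+ 2 *+ ((a < b)%N && (b < x)%N)) =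
          - (eps * (q^-1 * D a - q * D x)).
  rewrite -qdim_weight_telescope // mulrA -expr2 big_distrr /= -sumrN.
  rewrite (big_nat_widen _ _ n) ?(ltnW (ltn_ord x)) //.
  rewrite big_geq_mkord /= [RHS]big_mkcond; apply: eq_bigr => b _.
  by rewrite andbC; case: ifP; rewrite ?mulr1n ?mulr0n ?oppr0 ?mulr0 // mulrN mulrC.
by rewrite !mulr1n; ring.
Qed.

Variable A : algType K.
Implicit Type N : 'M[A]_n.
Local Notation R := (RmxA n A q).
Local Notation R' := (RmxA n A q^-1).

(** On the diagonal the factors q and q^-1 of R and R^-1 cancel; off the diagonal
    only N_ax occurs, with the coefficient of [qtrace_offdiag]. *)
Lemma qtrace_leg2 N a x :
  \sum_(b < n) D b *: (R' *m leg2 N *m R) ⟦a, b⟧ ⟦x, b⟧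
  = (\sum_(b < n) D b *: N b b) *+ (a == x).
Proof.
under eq_bigr do rewrite mulmx_RmxE !mul_RmxE !leg2E invrK.
have [<-|ax] := eqVneq a x.
  rewrite mulr1n; apply: eq_bigr => b _; congr (_ *: _).
  have [<-|ab] := eqVneq a b.
    by rewrite ltnn !scale0r !addr0 scalerA mulfV // scale1r.
  by rewrite !mulr0n !scaler0 !scale1r eqxx mulr1n add0r addr0; case: ltngtP => //;
    rewrite !scale0r ?scaler0 ?addr0.
rewrite mulr0n; have [ltax|leax] := ltnP a x; last first.
  rewrite big1 // => b _; rewrite mulr0n scaler0 add0r eqxx mulr1n.
  have -> : (if (a < b)%N then q^-1 - q else 0) *: (N a b *+ (b == x)) = 0.
    case: eqVneq => [->|_]; last by rewrite scaler0.
    by rewrite ltnNge leax scale0r.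
  have [bx|_] := ltnP b x; last by rewrite scale0r !scaler0 addr0 scaler0.
  have ba := leq_trans bx leax.
  have /negPf -> : a != b by rewrite -val_eqE neq_ltn ba orbT.
  rewrite [(a < b)%N]ltnNge (ltnW ba) /=.
  by rewrite scale0r mulr0n !(scaler0, addr0).
transitivity (0 *: N a x); last by rewrite scale0r.
rewrite -[X in _ = X *: _](qtrace_offdiag ltax) scaler_suml.
apply: eq_bigr => b _; rewrite -scalerA; congr (_ *: _).
rewrite !mulr0n !scaler0 add0r eqxx mulr1n.
have [->|bx] := eqVneq b x.
  rewrite ltnn ltax [x == a]eq_sym (negPf ax).
  rewrite mulr1n scale0r addr0 scalerA.
  by congr (_ *: _); rewrite /= ?mulr1n ?mulr0n; ring.
rewrite mulr0n scaler0 scaler0 add0r.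
have [->|ba] := eqVneq b a.
  rewrite ltnn ltax mulr1n scale0r addr0 scalerA.
  by congr (_ *: _); rewrite /= ?mulr1n ?mulr0n; ring.
rewrite !(scale1r, mulr0n, scaler0, add0r) scalerA.
congr (_ *: _).
by case: ltnP => _; case: ltnP => _; rewrite /= ?mulr1n ?mulr0n; ring.
Qed.

Lemma qtrace_leg1 N b y :
  \sum_(a < n) D a *: (R *m leg1 N *m R') ⟦a, b⟧ ⟦a, y⟧
  = (\sum_(a < n) D a *: N a a) *+ (b == y).
Proof.
under eq_bigr do rewrite mulmx_RmxE !mul_RmxE !leg1E invrK.
have [<-|yb] := eqVneq b y.
  rewrite mulr1n; apply: eq_bigr => a _; congr (_ *: _).
  have [<-|ab] := eqVneq a b.
    by rewrite ltnn !scale0r !addr0 scalerA mulVf // scale1r.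
  by rewrite !mulr0n !scaler0 !scale1r eqxx mulr1n add0r addr0; case: ltngtP => //;
    rewrite !scale0r ?scaler0 ?addr0.
rewrite mulr0n; have [ltyb|leyb] := ltnP y b; last first.
  rewrite big1 // => a _; rewrite mulr0n scaler0 add0r eqxx mulr1n.
  have -> : (if (a < b)%N then q - q^-1 else 0) *: (N b a *+ (a == y)) = 0.
    case: eqVneq => [->|_]; last by rewrite scaler0.
    by rewrite ltnNge leyb scale0r.
  have [ya|_] := ltnP y a; last by rewrite scale0r !scaler0 addr0 scaler0.
  have ba := leq_ltn_trans leyb ya.
  have ab : a == b = false by apply/negbTE; rewrite -val_eqE neq_ltn ba orbT.
  rewrite [b == a]eq_sym ab [(a < b)%N]ltnNge (ltnW ba) /=.
  by rewrite scale0r mulr0n !(scaler0, addr0).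
transitivity (0 *: N b y); last by rewrite scale0r.
rewrite -[X in _ = X *: _](qtrace_offdiag ltyb) scaler_suml.
apply: eq_bigr => a _; rewrite -scalerA; congr (_ *: _).
rewrite !mulr0n !scaler0 add0r eqxx mulr1n.
have [->|ay] := eqVneq a y.
  rewrite ltnn ltyb [y == b]eq_sym (negPf yb).
  rewrite !(mulr1n, mulr0n, scale0r, scaler0, addr0, add0r) scalerA.
  by congr (_ *: _); rewrite /= ?mulr1n ?mulr0n; ring.
rewrite mulr0n scaler0 addr0.
have [->|ba] := eqVneq a b.
  rewrite ltnn ltyb !(mulr1n, mulr0n, scaler0, scale0r, add0r, addr0) scalerA.
  by congr (_ *: _); rewrite /= ?mulr1n ?mulr0n; ring.
rewrite !(scale1r, mulr0n, scaler0, add0r) scalerA.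
congr (_ *: _).
by case: ltnP => _; case: ltnP => _; rewrite /= ?mulr1n ?mulr0n; ring.
Qed.

End QuantumTrace.

(** * Centrality of the quantum traces *)

Section FreeAlgebraInd.
Variables (K : fieldType) (I : choiceType).

Lemma free_alg_ind (P : free_alg K I -> Prop) :
  P 1 -> (forall x y, P x -> P y -> P (x + y)) ->
  (forall k x, P x -> P (k *: x)) ->
  (forall i x, P x -> P (free_gen K i * x)) -> forall x, P x.
Proof.
move=> P1 PD PZ PM.
have P0 : P 0 by rewrite -(scale0r 1); apply: PZ.
have Pw (s : seq I) : P (mkmalgU (FMonom s) 1).
  elim: s => [|i s IHs]; first by rewrite -fmoneE; apply: P1.
  suff -> : mkmalgU (FMonom (i :: s)) 1 =
      free_gen K i * (mkmalgU (FMonom s) 1 : free_alg K I) by apply: PM.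
  rewrite /free_gen malgM_def fgmulUU mul1r; congr mkmalgU.
  by rewrite fmuE /mmul /= fmmulE.
move=> x; rewrite (monalgE x).
elim/big_rec: _ => // w y _ Py; apply: PD => //.
have mkZ k : mkmalgU w k = k *: (mkmalgU w 1 : free_alg K I).
  by apply/malgP => v; rewrite malgZ_def fgscaleE !mcoeffU mulrnAr mulr1.
rewrite mkZ; apply: PZ; case: w {mkZ} => w; exact: Pw.
Qed.

End FreeAlgebraInd.

Section Exchange.
Variables (K : fieldType) (q : K) (n : nat).
Hypothesis q0 : q != 0.
Variables (A : algType K) (Lp Lm S : 'M[A]_n).
Hypotheses (LS : Lp *m S = 1%:M) (SL : S *m Lp = 1%:M).
Hypotheses (RLLpp : RLL q Lp Lp = 0) (RLLmm : RLL q Lm Lm = 0).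
Hypothesis RLLpm : RLL q Lp Lm = 0.
Local Notation R := (RmxA n A q).
Local Notation R' := (RmxA n A q^-1).
Local Notation M := (Lm *m S).

Lemma RLL_eq0 (L L' : 'M[A]_n) : RLL q L L' = 0 ->
  R *m leg1 L *m leg2 L' = leg2 L' *m leg1 L *m R.
Proof. by move/eqP; rewrite subr_eq0 => /eqP. Qed.

Lemma exprS_mx (X : 'M[A]_n) m : X ^+ m.+1 = X *m X ^+ m.
Proof. exact: exprS. Qed.

(** For m = 1: move R L^+_1 past L^-_2 by the mixed relation, then past S_2 by
    the relation for L^+ multiplied by S_2 on both sides.  What commutes with
    M_2 commutes with its powers. *)
Lemma exchange_plus m :
  R *m leg1 Lp *m leg2 (M ^+ m) = leg2 (M ^+ m) *m (R *m leg1 Lp).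
Proof.
elim: m => [|m IHm]; first by rewrite !expr0 leg2_1 mulmx1 mul1mx.
rewrite exprS_mx leg2M [LHS]mulmxA -[RHS]mulmxA -IHm.
rewrite [RHS]mulmxA; congr (_ *m _); rewrite leg2M !mulmxA.
rewrite (RLL_eq0 RLLpm) -!mulmxA; congr (_ *m _).
have SL2 : leg2 S *m leg2 Lp = 1%:M by rewrite -leg2M SL leg2_1.
have LS2 : leg2 Lp *m leg2 S = 1%:M by rewrite -leg2M LS leg2_1.
have /(congr1 (fun X => leg2 S *m X *m leg2 S)) := RLL_eq0 RLLpp.
by rewrite !mulmxA SL2 mul1mx -!mulmxA LS2 mulmx1 => ->.
Qed.

(** The same argument with the legs interchanged: inverting R brings the
    relations in a form where L^-_2 is moved past L^-_1 and S_1. *)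
Lemma exchange_minus m :
  R' *m leg2 Lm *m leg1 (M ^+ m) = leg1 (M ^+ m) *m (R' *m leg2 Lm).
Proof.
have R'R : R' *m R = 1%:M := RmxAV n A q0.
have RR' : R *m R' = 1%:M.
  by have := RmxAV n A (invr_neq0 q0); rewrite invrK.
have flip L L' : RLL q L L' = 0 ->
    leg1 L *m leg2 L' *m R' = R' *m leg2 L' *m leg1 L.
  move/RLL_eq0/(congr1 (fun X => R' *m X *m R')).
  by rewrite !mulmxA R'R mul1mx => ->; rewrite -!mulmxA RR' mulmx1.
elim: m => [|m IHm]; first by rewrite !expr0 leg1_1 mulmx1 mul1mx.
rewrite exprS_mx leg1M [LHS]mulmxA -[RHS]mulmxA -IHm.
rewrite [RHS]mulmxA; congr (_ *m _); rewrite leg1M !mulmxA.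
rewrite -(flip _ _ RLLmm) -!mulmxA; congr (_ *m _).
have SL1 : leg1 S *m leg1 Lp = 1%:M by rewrite -leg1M SL leg1_1.
have LS1 : leg1 Lp *m leg1 S = 1%:M by rewrite -leg1M LS leg1_1.
have /(congr1 (fun X => leg1 S *m X *m leg1 S)) := flip _ _ RLLpm.
by rewrite !mulmxA SL1 mul1mx -!mulmxA LS1 mulmx1 => ->.
Qed.

Definition qtrace (X : 'M[A]_n) : A := \sum_(b < n) qdim_weight q n b *: X b b.

(** Take the partial quantum trace over the second leg of
    L^+_1 N_2 = (R^-1 N_2 R) L^+_1. *)
Lemma qtrace_comm_plus m a c :
  Lp a c * qtrace (M ^+ m) = qtrace (M ^+ m) * Lp a c.
Proof.
set N := M ^+ m.
have E : leg1 Lp *m leg2 N = R' *m leg2 N *m R *m leg1 Lp.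
  rewrite -[RHS]mulmxA -[RHS]mulmxA -exchange_plus !mulmxA RmxAV //.
  by rewrite mul1mx.
have -> : Lp a c * qtrace N
    = \sum_(b < n) qdim_weight q n b *: (leg1 Lp *m leg2 N) ⟦a, b⟧ ⟦c, b⟧.
  by rewrite mulr_sumr; apply: eq_bigr => b _; rewrite leg12E scalerAr.
under eq_bigr do rewrite E mulmx_leg1E scaler_sumr.
rewrite exchange_big /= (bigD1 a) //= [X in _ + X]big1 ?addr0 => [|x /negPf xa].
  under eq_bigr do rewrite scalerAl.
  by rewrite -mulr_suml qtrace_leg2 // eqxx mulr1n.
under eq_bigr do rewrite scalerAl.
by rewrite -mulr_suml qtrace_leg2 // eq_sym xa mul0r.
Qed.

Lemma qtrace_comm_minus m b d :
  Lm b d * qtrace (M ^+ m) = qtrace (M ^+ m) * Lm b d.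
Proof.
set N := M ^+ m.
have E : leg2 Lm *m leg1 N = R *m leg1 N *m R' *m leg2 Lm.
  rewrite -[RHS]mulmxA -[RHS]mulmxA -exchange_minus !mulmxA.
  by have := RmxAV n A (invr_neq0 q0); rewrite invrK => ->; rewrite mul1mx.
have -> : Lm b d * qtrace N
    = \sum_(a < n) qdim_weight q n a *: (leg2 Lm *m leg1 N) ⟦a, b⟧ ⟦a, d⟧.
  by rewrite mulr_sumr; apply: eq_bigr => a _; rewrite leg21E scalerAr.
under eq_bigr do rewrite E mulmx_leg2E scaler_sumr.
rewrite exchange_big /= (bigD1 b) //= [X in _ + X]big1 ?addr0 => [|x /negPf xb].
  under eq_bigr do rewrite scalerAl.
  by rewrite -mulr_suml qtrace_leg1 // eqxx mulr1n.
under eq_bigr do rewrite scalerAl.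
by rewrite -mulr_suml qtrace_leg1 // eq_sym xb mul0r.
Qed.

(** The entry of [exchange_minus] at row (a, b) and column (b, d): with equal inner
    indices R^-1 contributes the initial part, over x < b, of the entry (a, d) of
    the product of M^m and L^-. *)
Lemma exchange_minusE m a b d (N := M ^+ m) :
  q^-1 *: (N a b * Lm b d)
  - (q - q^-1) *: (\sum_(x < n | (x < b)%N) N a x * Lm x d)
  = (if a == b then q^-1 else 1) *: (Lm b d * N a b)
    - (if (a < b)%N then q - q^-1 else 0) *: (Lm a d * N b b).
Proof.
have /matrixP/(_ ⟦a, b⟧ ⟦b, d⟧) := exchange_minus m.
rewrite -/N -mulmxA mul_RmxE !leg21E invrK mul_leg1E => E.
have {E} E : (if a == b then q^-1 else 1) *: (Lm b d * N a b) -
  (if (a < b)%N then q - q^-1 else 0) *: (Lm a d * N b b)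
  = \sum_x N a x * (R' *m leg2 Lm) ⟦x, b⟧ ⟦b, d⟧.
  by rewrite -E -scaleNr; case: ifP; case: ifP; rewrite ?oppr0 ?opprB.
rewrite E big_mkcond /= scaler_sumr -sumrN (bigD1 b) //= [RHS](bigD1 b) //=.
rewrite ltnn scaler0 oppr0 add0r; congr (_ + _).
  by rewrite mul_RmxE eqxx ltnn scale0r addr0 leg2E eqxx scalerAr.
apply: eq_bigr => x /negPf xb; rewrite mul_RmxE !leg2E xb eqxx invrK.
rewrite mulr0n scaler0 add0r mulr1n -scalerAr.
by case: ifP => _; rewrite ?scale0r ?mulr0 ?oppr0 ?scaler0 ?oppr0 // -scaleNr opprB.
Qed.

End Exchange.

Section Centrality.
Variables (K : fieldType) (q : K) (n : nat).
Hypothesis q0 : q != 0.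

Lemma trqE (X : 'M[Uq q n]_n) : trq X = qtrace q X.
Proof.
rewrite /trq /Dmx mul_diag_mx; apply: eq_bigr => b _.
by rewrite !mxE mulr_algl.
Qed.

Lemma trq_central m u : u * trq (Mmx q n ^+ m) = trq (Mmx q n ^+ m) * u.
Proof.
have gen s i j : Lmx q n s i j * trq (Mmx q n ^+ m) = trq (Mmx q n ^+ m) * Lmx q n s i j.
  rewrite trqE; case: s.
    exact: (qtrace_comm_plus q0 (mulLplusV q n) (mulVLplus q n)
      (Lmx_RLL q n true) (Lmx_RLL_pm q n)).
  exact: (qtrace_comm_minus q0 (mulLplusV q n) (mulVLplus q n)
    (Lmx_RLL q n false) (Lmx_RLL_pm q n)).
have [x ->] := Uq_piP u; elim/free_alg_ind: x => [|x y IHx IHy|k x IHx|g x IHx].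
- by rewrite rmorph1 mulr1 mul1r.
- by rewrite rmorphD mulrDl mulrDr IHx IHy.
- by rewrite linearZ -scalerAl IHx scalerAr.
rewrite rmorphM -mulrA IHx !mulrA; congr (_ * _).
by case: g => s [i j]; have := gen s i j; rewrite !mxE.
Qed.

End Centrality.

(** * Powers of M on a highest weight vector *)

Section GelfandDiag.
Variables (K : fieldType) (n : nat) (p : K) (x : nat -> K).

(** The upper end k is a parameter because the sums cut off at k describe the
    partial sums in [exchange_sum_diag]. *)
Definition tail_sum (f : nat -> K) (k i : nat) : K :=
  \sum_(i <= l < k) p ^+ (l - i) * f l.

(** The scalar by which the diagonal entry (M^m)_ii acts on the highest weight
    vector, see [Mpow_highest_weight].  It is polynomial in x. *)
Fixpoint gelfand_diag (m i : nat) : K :=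
  if m is m'.+1 then
    x i * (tail_sum (gelfand_diag m') n i - tail_sum (gelfand_diag m') n i.+1)
  else 1.

End GelfandDiag.

Lemma tail_sum_recr (K : fieldType) (p : K) f k i : (i <= k)%N ->
  tail_sum p f k.+1 i = tail_sum p f k i + p ^+ (k - i) * f k.
Proof. by move=> ik; rewrite /tail_sum big_nat_recr. Qed.

(** The base field acts on a module over the algebra A through the scalars
    k%:A, which commute with A. *)
Section ScalarAction.
Variables (K : fieldType) (A : algType K) (V : lmodType A).
Implicit Types (k : K) (X : A) (v : V).

Lemma scaleralg k X v : (k *: X) *: v = k%:A *: (X *: v).
Proof. by rewrite scalerA mulr_algl. Qed.

Lemma scalerCalg k X v : X *: (k%:A *: v) = k%:A *: (X *: v).
Proof. by rewrite !scalerA mulr_algl mulr_algr. Qed.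

Lemma scalerMalg k l v : k%:A *: (l%:A *: v) = (k * l)%:A *: v.
Proof. by rewrite scalerA mulr_algl scalerA. Qed.

Lemma scalerDalg k l v : k%:A *: v + l%:A *: v = (k + l)%:A *: v.
Proof. by rewrite -!scalerDl. Qed.

Lemma scalerNalg k v : - (k%:A *: v) = (- k)%:A *: v.
Proof. by rewrite -!scaleNr. Qed.

End ScalarAction.

Section HighestWeight.
Variables (K : fieldType) (q : K) (n : nat).
Hypothesis q0 : q != 0.
Variables (A : algType K) (Lp Lm S : 'M[A]_n).
Hypotheses (LS : Lp *m S = 1%:M) (SL : S *m Lp = 1%:M).
Hypotheses (RLLmm : RLL q Lm Lm = 0) (RLLpm : RLL q Lp Lm = 0).
Hypothesis Lp_upper : forall i j : 'I_n, (j < i)%N -> Lp i j = 0.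
Hypothesis Lm_lower : forall i j : 'I_n, (i < j)%N -> Lm i j = 0.
Hypothesis Lpm_diag : forall i : 'I_n, Lp i i * Lm i i = 1.
Local Notation M := (Lm *m S).

Variables (V : lmodType A) (xi : V) (w : 'I_n -> K).
Hypothesis w0 : forall i, w i != 0.
Hypothesis Lp_xi : forall i j : 'I_n, (i < j)%N -> Lp i j *: xi = 0.
Hypothesis Lm_xi : forall i, Lm i i *: xi = (w i)%:A *: xi.

Variable x : nat -> K.
Hypothesis xE : forall i : 'I_n, x i = w i ^+ 2 * q ^+ (2 * (n - i.+1)).

Lemma S_highest_weight i j : S i j *: xi = (w j *+ (i == j))%:A *: xi.
Proof.
have LpE k : Lp k j *: xi = ((w j)^-1 *+ (k == j))%:A *: xi.
  case: (ltngtP k j) => [kj|jk|/val_inj ->].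
  - by rewrite Lp_xi // -val_eqE ltn_eqF // scale0r scale0r.
  - by rewrite Lp_upper // -val_eqE gtn_eqF // !scale0r.
  have := congr1 (fun X => X *: xi) (Lpm_diag j).
  rewrite /= -scalerA Lm_xi scalerCalg scale1r => E.
  by rewrite -[in RHS]E scalerMalg eqxx mulr1n mulVf // !scale1r.
have /matrixP/(_ i j)/(congr1 (fun X => X *: xi)) := SL.
rewrite !mxE /= scaler_suml (bigD1 j) //= big1 ?addr0 => [|k /negPf kj].
  rewrite -scalerA LpE eqxx scalerCalg => /(congr1 (fun v => (w j)%:A *: v)).
  rewrite scalerMalg mulr1n mulfV // !scale1r => ->.
  by case: eqP; rewrite ?scale1r // !scale0r scaler0.
by rewrite -scalerA LpE kj !scale0r scaler0.
Qed.

Lemma M_highest_weight i j : M i j *: xi = (w j)%:A *: (Lm i j *: xi).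
Proof.
rewrite mxE scaler_suml (bigD1 j) //= big1 ?addr0 => [|k /negPf kj].
  by rewrite -scalerA S_highest_weight eqxx mulr1n scalerCalg.
by rewrite -scalerA S_highest_weight kj !scale0r scaler0.
Qed.

Section Step.
Variables (m : nat) (nu : nat -> K).
Local Notation N := (M ^+ m).
Hypothesis N_upper : forall i j : 'I_n, (i < j)%N -> N i j *: xi = 0.
Hypothesis N_diag : forall i : 'I_n, N i i *: xi = (nu i)%:A *: xi.

(** Apply the entry [exchange_minusE] to xi.  In its right hand side
    l^-_kj N_ik xi vanishes unless k = i = j, by triangularity of l^- for k < i and
    of N for k > i, and l^-_ij N_kk xi is nu_k times l^-_ij xi, zero unless i = j.
    What is left is the recursion T_(k+1) = q^2 T_k + (scalar) xi for the partial
    sums T_k, which determines them from T_0 = 0. *)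
Lemma exchange_partial_sum (i j : 'I_n) (C : nat -> K) :
  (i <= j)%N -> C 0%N = 0 ->
  (forall k, (k < n)%N -> C k.+1 = q ^+ 2 * C k
     + (q * (if (k < i)%N then 0 else if k == i then q^-1 else - (q - q^-1)))
       * (w i * nu k) *+ (i == j)) ->
  forall k, (k <= n)%N ->
  \sum_(y < n | (y < k)%N) (N i y * Lm y j) *: xi = (C k)%:A *: xi.
Proof.
move=> ij C0 CS; elim=> [|k IHk] kn.
  by rewrite big_pred0 // C0 !scale0r.
pose k' := Ordinal kn.
rewrite (bigD1 k') //= (eq_bigl (fun y : 'I_n => (y < k)%N)); last first.
  by move=> y; rewrite ltnS -val_eqE /= [RHS]ltn_neqAle andbC.
rewrite IHk ?(ltnW kn) //.
have := congr1 (fun X => X *: xi) (exchange_minusE q0 LS SL RLLmm RLLpm m i k' j).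
rewrite /= 2![(_ - _) *: xi]scalerBl (scaleralg _ (N i k' * _)) (scaleralg _ (Lm k' j * _)).
rewrite (scaleralg _ (Lm i j * _)) (scaleralg _ (\sum_(_ < _ | _) _)).
rewrite scaler_suml IHk ?(ltnW kn) // -2![(Lm _ _ * _) *: _]scalerA.
have -> : Lm i j *: (N k' k' *: xi) = ((w i * nu k) *+ (i == j))%:A *: xi.
  rewrite N_diag scalerCalg; have [<-|nij] := eqVneq i j.
    by rewrite Lm_xi scalerMalg mulrC.
  by rewrite Lm_lower ?scale0r ?scaler0 // ltn_neqAle ij andbT.
have -> : (if i == k' then q^-1 else 1)%:A *: (Lm k' j *: (N i k' *: xi))
   = ((if k == i then q^-1 else 0) * (w i * nu k) *+ (i == j))%:A *: xi.
  case: (ltngtP k i) => [ki|ik|ki].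
  - by rewrite Lm_lower ?(leq_trans ki) // !scale0r scaler0 mul0r mul0rn scale0r scale0r.
  - by rewrite N_upper // !scaler0 mul0r mul0rn !scale0r.
  have -> : k' = i by apply: val_inj.
  rewrite eqxx N_diag scalerCalg; have [<-|nij] := eqVneq i j.
    by rewrite Lm_xi !scalerMalg ki mulr1n; congr (_%:A *: _); ring.
  by rewrite Lm_lower ?scale0r ?scaler0 ?mulr0n ?scale0r // ltn_neqAle ij andbT.
rewrite !scalerMalg => /(canRL (subrK _)).
rewrite scalerNalg !scalerDalg => /(congr1 (fun v => q%:A *: v)) /=.
rewrite !scalerMalg mulfV // !scale1r => ->.
rewrite scalerDalg CS //; congr (_%:A *: _).
by case: (ltngtP k i) => _; case: (i == j); rewrite ?mulr1n ?mulr0n; field.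
Qed.

Lemma exchange_sum_upper (i j : 'I_n) : (i < j)%N ->
  \sum_y (N i y * Lm y j) *: xi = 0.
Proof.
move=> ij; have /negPf nij : i != j by rewrite -val_eqE neq_ltn ij.
have E := @exchange_partial_sum i j (fun=> 0) (ltnW ij) erefl.
apply: etrans (etrans (E _ n (leqnn n)) _); last by rewrite !scale0r.
  by apply: eq_bigl => y; rewrite ltn_ord.
by move=> k _; rewrite nij mulr0n mulr0 addr0.
Qed.

Lemma exchange_sum_diag (i : 'I_n) :
  \sum_y (N i y * Lm y i) *: xi =
  (w i * q ^+ (2 * (n - i.+1))
   * (tail_sum (q ^- 2) nu n i - tail_sum (q ^- 2) nu n i.+1))%:A *: xi.
Proof.
(* The partial sums vanish up to k = i, because l^-_yi = 0 for y < i. *)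
pose C k := if (i < k)%N then w i * q ^+ (2 * (k - i.+1))
   * (tail_sum (q ^- 2) nu k i - tail_sum (q ^- 2) nu k i.+1) else 0.
have E := @exchange_partial_sum i i C (leqnn i) erefl.
apply: etrans (etrans (E _ n (leqnn n)) _); last by rewrite /C ltn_ord.
  by apply: eq_bigl => y; rewrite ltn_ord.
move=> k kn; rewrite /C eqxx mulr1n ltnS.
case: (ltngtP k i) => [ki|ik|->].
- by rewrite !mulr0 mul0r addr0.
- rewrite !tail_sum_recr ?(ltnW ik) // subSn // mulnS exprD -[(k - i)%N]prednK ?subn_gt0 //.
  rewrite -subnS; set e := (k - i.+1)%N; rewrite [_ ^+ e.+1]exprS.
  have -> : q ^+ (2 * e) = (q ^- 2 ^+ e)^-1 by rewrite exprVn invrK exprM.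
  have : q ^- 2 ^+ e != 0 by rewrite expf_neq0 // invr_neq0 // expf_neq0.
  move: (q ^- 2 ^+ e) (tail_sum _ _ _ _) (tail_sum _ _ _ _) => u s1 s2 u0.
  by field; rewrite u0 q0.
rewrite subnn muln0 expr0 tail_sum_recr // subnn /tail_sum !big_geq //.
by field.
Qed.

Lemma Mpow_upperS (i j : 'I_n) : (i < j)%N -> (M ^+ m.+1) i j *: xi = 0.
Proof.
move=> ij; rewrite exprSr [X in X *: _]mxE scaler_suml.
under eq_bigr do rewrite -scalerA M_highest_weight scalerCalg scalerA.
by rewrite -scaler_sumr exchange_sum_upper // scaler0.
Qed.

Lemma Mpow_diagS (i : 'I_n) :
  (M ^+ m.+1) i i *: xi
  = (x i * (tail_sum (q ^- 2) nu n i - tail_sum (q ^- 2) nu n i.+1))%:A *: xi.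
Proof.
rewrite exprSr [X in X *: _]mxE scaler_suml.
under eq_bigr do rewrite -scalerA M_highest_weight scalerCalg scalerA.
rewrite -scaler_sumr exchange_sum_diag scalerMalg xE; congr (_%:A *: _); ring.
Qed.

End Step.

(** M_kj xi is w_j l^-_kj xi, so (M^(m+1))_ij xi is w_j times the full sum computed
    in [exchange_sum_upper] and [exchange_sum_diag]. *)
Lemma Mpow_highest_weight m :
  (forall i j : 'I_n, (i < j)%N -> (M ^+ m) i j *: xi = 0) /\
  (forall i : 'I_n, (M ^+ m) i i *: xi = (gelfand_diag n (q ^- 2) x m i)%:A *: xi).
Proof.
elim: m => [|m [IHu IHd]].
  by split=> [i j ij|i]; rewrite expr0 mxE ?eqxx ?scale1r // -val_eqE ltn_eqF // scale0r.
split=> [i j|i]; first exact: (Mpow_upperS IHu IHd).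
exact: (Mpow_diagS IHu IHd).
Qed.

End HighestWeight.

(** * Closed form of the recursion *)

Lemma downward_ind (P : nat -> Prop) n :
  P n -> (forall i, (i < n)%N -> P i.+1 -> P i) -> forall i, (i <= n)%N -> P i.
Proof.
move=> Pn PS i lein; rewrite -(subKn lein).
elim: (n - i)%N (leq_subr i n) => [|d IHd] dn; first by rewrite subn0.
apply: PS; first by rewrite ltn_subrL /= (leq_ltn_trans _ dn).
by rewrite -subSn // subSS; apply: IHd; apply: ltnW.
Qed.

Section ClosedForm.
Variables (K : fieldType) (n : nat) (p : K) (x : nat -> K).
Hypothesis x_inj : forall i j, (i < n)%N -> (j < n)%N -> i != j -> x i != x j.

(** Up to a factor, the residue at z = x_k of the rational function in
    [partial_fractions]. *)
Definition residue (i k : nat) : K :=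
  \prod_(i <= j < n | j != k) ((x j - p * x k) / (x j - x k)).

Definition residue_sum (m i : nat) : K := \sum_(i <= k < n) x k ^+ m * residue i k.

Lemma residue_self i : (i < n)%N ->
  residue i i = \prod_(i.+1 <= j < n) ((x j - p * x i) / (x j - x i)).
Proof.
move=> ltin; rewrite /residue big_ltn_cond // eqxx /=.
rewrite big_nat_cond [RHS]big_nat_cond; apply: eq_bigl => j.
by case: (ltngtP i j) => //=; rewrite ?andbT ?andbF.
Qed.

Lemma residueS i k : (i < k)%N -> (k < n)%N ->
  residue i k = (x i - p * x k) / (x i - x k) * residue i.+1 k.
Proof.
by move=> ik kn; rewrite /residue big_ltn_cond ?(ltn_trans ik) // ltn_eqF.
Qed.

Lemma residue_sumS m i : (i < n)%N ->
  residue_sum m i = x i ^+ m * residue i i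
    + \sum_(i.+1 <= k < n) x k ^+ m * ((x i - p * x k) / (x i - x k) * residue i.+1 k).
Proof.
move=> ltin; rewrite /residue_sum big_ltn //; congr (_ + _).
by apply: eq_big_nat => k /andP[ik kn]; rewrite residueS.
Qed.

(** Downward induction on i.  The residue at the new pole x_i is the product over
    the remaining indices at z = x_i, to which the induction hypothesis
    applies again. *)
Lemma partial_fractions i z : (i <= n)%N ->
  (forall j, (i <= j < n)%N -> x j != z) ->
  \prod_(i <= j < n) ((x j - p * z) / (x j - z)) =
  p ^+ (n - i) + (1 - p) * \sum_(i <= k < n) x k / (x k - z) * residue i k.
Proof.
move=> lein; elim/downward_ind: i / lein z => [|i ltin IHi] z zx.
  by rewrite subnn !big_geq // mulr0 addr0.
rewrite big_ltn // [X in _ = _ + _ * X]big_ltn // residue_self //.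
rewrite IHi; last first.
  by move=> j /andP[ij jn]; apply: zx; rewrite jn andbT ltnW.
rewrite IHi; last first.
  by move=> j /andP[ij jn]; rewrite x_inj // gtn_eqF.
have zi : x i - z != 0 by rewrite subr_eq0 zx // leqnn.
have -> : \sum_(i.+1 <= k < n) x k / (x k - z) * residue i k =
  \sum_(i.+1 <= k < n) x k / (x k - z) * ((x i - p * x k) / (x i - x k) * residue i.+1 k).
  by apply: eq_big_nat => k /andP[ik kn]; rewrite residueS.
rewrite -[(n - i)%N]prednK ?subn_gt0 // -subnS exprS.
set c := residue i.+1.
have -> : \sum_(i.+1 <= k < n) x k / (x k - z) * ((x i - p * x k) / (x i - x k) * c k)
  = (x i - p * z) / (x i - z) * (\sum_(i.+1 <= k < n) x k / (x k - z) * c k)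
   - (1 - p) * (x i / (x i - z)) * \sum_(i.+1 <= k < n) x k / (x k - x i) * c k.
  rewrite !mulr_sumr -sumrB; apply: eq_big_nat => k /andP[ik kn].
  have kz : x k - z != 0.
    by rewrite subr_eq0 zx // kn andbT (leq_trans _ ik) //.
  have ki : x k - x i != 0 by rewrite subr_eq0 x_inj // gtn_eqF //.
  have ik' : x i - x k != 0 by rewrite -opprB oppr_eq0.
  by field; rewrite ik' ki kz zi.
by field; rewrite zi.
Qed.

(** By [partial_fractions] at z = x_i, the summand k = i turns into a sum over
    k > i, and it combines with the other summands term by term. *)
Lemma residue_sum0 i : (i < n)%N ->
  residue_sum 0 i = residue_sum 0 i.+1 + p ^+ (n - i.+1).
Proof.
move=> ltin; rewrite residue_sumS // expr0 mul1r residue_self //.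
rewrite partial_fractions => [||j /andP[ij jn]] //; last first.
  by rewrite x_inj // gtn_eqF.
rewrite mulr_sumr -addrA -big_split /= addrC; congr (_ + _).
apply: eq_big_nat => k /andP[ik kn]; rewrite expr0 mul1r.
have ki : x k - x i != 0 by rewrite subr_eq0 x_inj // gtn_eqF.
have ik' : x i - x k != 0 by rewrite -opprB oppr_eq0.
by field; rewrite ik' ki.
Qed.

(** The factor x_k - x_i of x_k^(m+1) - x_i x_k^m cancels the denominator that
    the index i contributes to the residue at k. *)
Lemma residue_sum_recl m i : (i < n)%N ->
  residue_sum m.+1 i =
  x i * (residue_sum m i - residue_sum m i.+1) + p * residue_sum m.+1 i.+1.
Proof.
move=> ltin; rewrite !(residue_sumS _ ltin) mulrBr mulrDr -!addrA.
congr (_ + _); first by rewrite exprS mulrA.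
rewrite /residue_sum !mulr_sumr -sumrN -!big_split /=.
apply: eq_big_nat => k /andP[ik kn].
have ik' : x i - x k != 0 by rewrite subr_eq0 x_inj // ltn_eqF.
by rewrite exprS; field.
Qed.

Lemma tail_sum_recl f i : (i < n)%N ->
  tail_sum p f n i = f i + p * tail_sum p f n i.+1.
Proof.
move=> ltin; rewrite /tail_sum big_ltn // subnn mul1r mulr_sumr; congr (_ + _).
by apply: eq_big_nat => l /andP[il _]; rewrite mulrA -exprS -subSn.
Qed.

Lemma tail_sum_gelfand_diag m i : (i <= n)%N ->
  tail_sum p (gelfand_diag n p x m) n i = residue_sum m i.
Proof.
elim: m i => [|m IHm] i; elim/downward_ind: i / => [|i ltin IHi].
- by rewrite /tail_sum /residue_sum !big_geq.
- have shift k (F : nat -> K) : \sum_(k <= l < n) F l = \sum_(0 <= l < n - k) F (l + k)%N.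
    by rewrite -(big_addn 0 n k xpredT) add0n.
  rewrite residue_sum0 // -IHi /tail_sum /= !shift.
  rewrite -[(n - i)%N]prednK ?subn_gt0 // -subnS big_nat_recr //= addnK mulr1.
  by congr (_ + _); apply: eq_bigr => l _; rewrite !addnK.
- by rewrite /tail_sum /residue_sum !big_geq.
by rewrite tail_sum_recl // residue_sum_recl // IHi /= !IHm // ltnW.
Qed.

End ClosedForm.

(** * The eigenvalue in terms of q-numbers *)

Section Eigenvalue.
Variables (R : realType) (n : nat) (h : R[i]).
Local Open Scope complex_scope.
Implicit Types mu : 'rV[R]_n.
Local Notation q := (cexp h).
Hypothesis q2 : q - q^-1 != 0.

Lemma qpowD a b : qpow h (a + b) = qpow h a * qpow h b.
Proof. by rewrite /qpow rmorphD mulrDr cexpD. Qed.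

Lemma qpow_neq0 a : qpow h a != 0. Proof. exact: cexp_neq0. Qed.

Lemma qpow0 : qpow h 0 = 1. Proof. by rewrite /qpow rmorph0 mulr0 cexp0. Qed.

Lemma qpow1 : qpow h 1 = q. Proof. by rewrite /qpow rmorph1 mulr1. Qed.

Lemma qpowN a : qpow h (- a) = (qpow h a)^-1.
Proof. by apply: (mulfI (qpow_neq0 a)); rewrite -qpowD subrr qpow0 mulfV ?qpow_neq0. Qed.

Lemma qpowMn a m : qpow h (a * m%:R) = qpow h a ^+ m.
Proof.
elim: m => [|m IHm]; first by rewrite mulr0 qpow0.
by rewrite -natr1 mulrDr mulr1 qpowD IHm exprSr.
Qed.

Lemma qpow_nat m : qpow h m%:R = q ^+ m.
Proof. by rewrite -[m%:R]mul1r qpowMn qpow1. Qed.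

Lemma qnum1 : qnum h 1 = 1.
Proof. by rewrite /qnum qpowN qpow1 divff. Qed.

(** The variables x_i = q^(2 l_i), indexed by all natural numbers as
    [gelfand_diag] requires; the default value 0 is never read. *)
Definition weight_var mu (i : nat) : R[i] :=
  if insub i is Some i' then qpow h (ell mu i') ^+ 2 else 0.

Lemma weight_varE mu (i : 'I_n) : weight_var mu i = qpow h (ell mu i) ^+ 2.
Proof. by rewrite /weight_var valK. Qed.

(** The eigenvalue at an arbitrary weight, free of denominators. *)
Definition gelfand_poly m mu : R[i] :=
  \sum_(i < n) qdim_weight q n i * gelfand_diag n (q ^- 2) (weight_var mu) m i.

(** In the variables y_i = q^(l_i), with x_i = y_i^2, the ratio
    [l_i - l_k + 1] / [l_i - l_k] is q (x_i - q^-2 x_k) / (x_i - x_k); the n - 1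
    factors q make up q^(n-1). *)
Lemma gelfand_poly_regular m mu : regular_weight h mu ->
  gelfand_poly m mu = gelfand_eigenvalue h m mu.
Proof.
move=> reg; set x := weight_var mu.
have sqr_neq (i k : 'I_n) : i != k -> qpow h (ell mu i) ^+ 2 - qpow h (ell mu k) ^+ 2 != 0.
  move=> ik; have := reg i k ik; apply: contra_neq => E.
  rewrite /qnum qpowN qpowD qpowN.
  suff -> : qpow h (ell mu i) / qpow h (ell mu k) - (qpow h (ell mu i) / qpow h (ell mu k))^-1
     = (qpow h (ell mu i) ^+ 2 - qpow h (ell mu k) ^+ 2)
       / (qpow h (ell mu i) * qpow h (ell mu k)).
    by rewrite E !mul0r.
  by field; rewrite !qpow_neq0.
have x_inj i j : (i < n)%N -> (j < n)%N -> i != j -> x i != x j.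
  move=> lti ltj ij; rewrite -subr_eq0 /x.
  rewrite (weight_varE mu (Ordinal lti)) (weight_varE mu (Ordinal ltj)).
  exact: sqr_neq.
have q0 := cexp_neq0 h.
transitivity (q ^ (n%:Z - 1) * tail_sum (q ^- 2) (gelfand_diag n (q ^- 2) x m) n 0).
  rewrite /tail_sum mulr_sumr big_mkord; apply: eq_bigr => i _.
  rewrite subn0 mulrA; congr (_ * _).
  by rewrite /qdim_weight expfzDr // -exprnN exprVn -exprM.
rewrite (tail_sum_gelfand_diag _ x_inj) // /residue_sum big_mkord mulr_sumr.
apply: eq_bigr => k _.
rewrite -mulrA qpowMn mulrCA; congr (_ * _).
  by rewrite /x weight_varE -(qpowMn _ 2) [2 * _]mulrC.
rewrite [\prod_(i < n) qnum _ _](bigD1 k) //= subrr add0r qnum1 mul1r.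
rewrite -prodf_div /residue big_mkord.
have -> : q ^ (n%:Z - 1) = \prod_(i < n | i != k) q.
  rewrite prodr_const cardC1 card_ord; case: (n) k => [[]//|n' _].
  by rewrite intS addrC addKr.
rewrite -big_split /=; apply: eq_bigr => i ik; rewrite /x !weight_varE.
have := sqr_neq i k ik; move: (ell mu i) (ell mu k) => a b.
rewrite /qnum !qpowN !qpowD qpow1 !qpowN.
move: (qpow_neq0 a) (qpow_neq0 b); move: (qpow h a) (qpow h b) => y z y0 z0 yz.
have yz' : (y / z - (y / z)^-1) = (y ^+ 2 - z ^+ 2) / (y * z) by field; rewrite y0 z0.
rewrite yz'.
have -> : q * ((y ^+ 2 - q ^- 2 * z ^+ 2) / (y ^+ 2 - z ^+ 2))
  = (y / z * q - (y / z * q)^-1) * (y * z) / (y ^+ 2 - z ^+ 2).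
  by field; rewrite y0 z0 q0 yz.
by move: (q - q^-1) q2 (y ^+ 2 - z ^+ 2) yz => e e0 d d0; field; rewrite e0 d0 y0 z0.
Qed.

End Eigenvalue.

(** * Continuity in the weight *)

Section GelfandDiagContinuity.
Variables (K : numFieldType) (T : Type) (F : set_system T).
Hypothesis FF : Filter F.
Local Open Scope classical_set_scope.

(** The next three lemmas put [cvgM], [cvgD] and [cvg_cst] at the regular module
    K^o, which carries the topology when K is the field of complex numbers. *)
Lemma cvg_mul (f g : T -> K) (a b : K) :
  (f t : K^o) @[t --> F] --> (a : K^o) -> (g t : K^o) @[t --> F] --> (b : K^o) ->
  (f t * g t : K^o) @[t --> F] --> (a * b : K^o).
Proof. exact: cvgM. Qed.

Lemma cvg_add (f g : T -> K) (a b : K) :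
  (f t : K^o) @[t --> F] --> (a : K^o) -> (g t : K^o) @[t --> F] --> (b : K^o) ->
  (f t + g t : K^o) @[t --> F] --> (a + b : K^o).
Proof. exact: cvgD. Qed.

Lemma cvg_const (a : K) : (a : K^o) @[_ --> F] --> (a : K^o).
Proof. exact: cvg_cst. Qed.

Lemma cvg_sum (I : Type) (r : seq I) (f : I -> T -> K) (a : I -> K) :
  (forall i, (f i t : K^o) @[t --> F] --> (a i : K^o)) ->
  (\sum_(i <- r) f i t : K^o) @[t --> F] --> (\sum_(i <- r) a i : K^o).
Proof.
by move=> fa; apply: (@cvg_big K^o) => [|i _]; [exact: add_continuous | exact: fa].
Qed.

Lemma cvg_gelfand_diag n p (x : T -> nat -> K) (x0 : nat -> K) m i :
  (forall j, (x t j : K^o) @[t --> F] --> (x0 j : K^o)) ->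
  (gelfand_diag n p (x t) m i : K^o) @[t --> F] --> (gelfand_diag n p x0 m i : K^o).
Proof.
move=> xx0; elim: m i => [|m IHm] i /=; first exact: cvg_cst.
have tailP k : (tail_sum p (gelfand_diag n p (x t) m) n k : K^o)
    @[t --> F] --> (tail_sum p (gelfand_diag n p x0 m) n k : K^o).
  by apply: cvg_sum => l; apply: cvg_mul; [exact: cvg_cst | exact: IHm].
by apply: cvg_mul => //; apply: (@cvgB _ K^o); exact: tailP.
Qed.

End GelfandDiagContinuity.

Section Continuity.
Variable R : realType.
Local Open Scope complex_scope.
Local Open Scope classical_set_scope.

Lemma cvg_real_complex {T : Type} {F : set_system T} {FF : Filter F} (f : T -> R) (a : R) :
  f x @[x --> F] --> a -> ((f x)%:C : R[i]^o) @[x --> F] --> (a%:C : R[i]^o).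
Proof.
move=> /cvgrPdist_lt fa; apply/cvgrPdist_lt => -[e e'].
rewrite ltcE /= => /andP[/eqP -> e0].
apply: filterS (fa e e0) => x.
by rewrite -rmorphB normc_def /= expr0n addr0 sqrtr_sqr ltcR.
Qed.

Lemma cvg_qpow h {T : Type} {F : set_system T} {FF : Filter F} (f : T -> R) (a : R) :
  f x @[x --> F] --> a -> (qpow h (f x) : R[i]^o) @[x --> F] --> (qpow h a : R[i]^o).
Proof.
move=> fa; case: h => u v.
have E t : qpow (u +i* v) t
    = (expR (u * t))%:C * ((cos (v * t))%:C + 'i * (sin (v * t))%:C).
  by rewrite /qpow /cexp /= !mulr0 subr0 add0r [X in _ * X = _]complexE.
rewrite E; under eq_cvg do rewrite E.
have lin c : c * f x @[x --> F] --> c * a by apply: cvgM => //; exact: cvg_cst.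
have comp (g : R -> R) c : continuous g ->
    ((g (c * f x))%:C : R[i]^o) @[x --> F] --> ((g (c * a))%:C : R[i]^o).
  move=> gc; apply: cvg_real_complex; apply: continuous_cvg (lin c); exact: gc.
apply: cvg_mul; first by apply: comp => z; exact: continuous_expR.
apply: cvg_add; first by apply: comp => z; exact: continuous_cos.
apply: cvg_mul; first exact: cvg_const.
by apply: comp => z; exact: continuous_sin.
Qed.

Variables (n : nat) (h : R[i]).

Lemma cvg_weight_var i (lambda : 'rV[R]_n) :
  (weight_var h mu i : R[i]^o) @[mu --> nbhs lambda] --> (weight_var h lambda i : R[i]^o).
Proof.
rewrite /weight_var; case: insubP => [i' _ _|_]; last exact: cvg_const.
suff H : (qpow h (ell mu i') : R[i]^o) @[mu --> nbhs lambda]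
    --> (qpow h (ell lambda i') : R[i]^o).
  by under eq_cvg do rewrite expr2; rewrite expr2; apply: cvg_mul.
apply: cvg_qpow; apply: cvgD; last exact: cvg_cst.
exact: coord_continuous.
Qed.

Lemma gelfand_poly_continuous m (lambda : 'rV[R]_n) :
  (gelfand_poly h m mu : R[i]^o) @[mu --> nbhs lambda] --> (gelfand_poly h m lambda : R[i]^o).
Proof.
apply: cvg_sum => i; apply: cvg_mul; first exact: cvg_const.
by apply: cvg_gelfand_diag => j; exact: cvg_weight_var.
Qed.

End Continuity.

(** * Eigenvalues of the quantum Gelfand invariants *)

Local Open Scope classical_set_scope.

Theorem theorem1p1 (R : realType) (n : nat) (q h : R[i])
  (q_neq0 : q != 0) (q_not_root1 : forall k : nat, (0 < k)%N -> q ^+ k != 1)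
  (h_log : cexp h = q)
  (lambda : 'rV[R]_n) (V : lmodType (Uq q n))
  (V_irr : irreducible_module V)
  (V_hw : exists xi : V,
      highest_weight_vector (fun i => qpow h (lambda 0 i)) xi)
  (m : nat) :
  exists c : R[i],
    [/\ (forall v : V, trq (Mmx q n ^+ m) *: v = c%:A *: v),
        (regular_weight h lambda -> c = gelfand_eigenvalue h m lambda)
      & (gelfand_eigenvalue h m mu : R[i]^o)
          @[mu --> within (regular_weight h) (nbhs lambda)] --> (c : R[i]^o)].
Proof.
have q2 : cexp h - (cexp h)^-1 != 0.
  rewrite h_log subr_eq0; apply: contra (q_not_root1 2 isT) => /eqP E.
  by rewrite expr2 {1}E mulVf.
exists (gelfand_poly h m lambda); split.
- case: V_hw => xi [xi0 Lp_xi Lm_xi gen] v.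
  have [u ->] := gen v.
  rewrite scalerA -trq_central // -scalerA -[RHS]scalerCalg; congr (_ *: _).
  have xE (i : 'I_n) : weight_var h lambda i
      = qpow h (lambda 0 i) ^+ 2 * q ^+ (2 * (n - i.+1)).
    by rewrite weight_varE /ell qpowD qpow_nat h_log exprMn -exprM mulnC.
  have [_ Mdiag] := Mpow_highest_weight q_neq0 (mulLplusV q n) (mulVLplus q n)
    (Lmx_RLL q n false) (Lmx_RLL_pm q n) (fun i j ji => Lmx_plus0 q ji)
    (@Lmx_minus0 _ q n) (@Lmx_diag_pm _ q n)
    (fun i => qpow_neq0 h (lambda 0 i)) Lp_xi Lm_xi xE m.
  rewrite trqE /qtrace scaler_suml /gelfand_poly.
  under eq_bigr do rewrite scaleralg Mdiag scalerMalg.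
  by rewrite -scaler_suml -scaler_suml h_log.
- exact: gelfand_poly_regular.
have C := @gelfand_poly_continuous _ n h m lambda.
apply: cvg_trans (cvg_within_filter (regular_weight h) C).
apply: near_eq_cvg; rewrite near_withinE; apply: nearW => mu reg.
exact: gelfand_poly_regular.
Qed.
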